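(* Let $\alpha,\rho>-1$ and $\mu\ge 0$ be real numbers. (i) For integers $n,m\ge 0$ put $I_{n,m}=\int_{-1}^1\left(\frac{1-x}{2}\right)^\mu P_n^{(\alpha,0)}(x)\,P_m^{(\rho,0)}(x)\,dx$. Then for all integers $n,m\ge 1$ $$(m+n+\mu+1)\,I_{n,m}=(m+n+\alpha+\rho-\mu-1)\,I_{n-1,m-1}+(n-m+\alpha-\mu-1)\,I_{n-1,m}+(m-n+\rho-\mu-1)\,I_{n,m-1}.$$ (ii) For integers $n,m\ge 1$ put $I^{(2)}_{n,m}=\int_{-1}^1\left(\frac{1-x}{2}\right)^\mu \widehat{p}_n^{(\alpha,0)}(x)\,\widehat{p}_m^{(\rho,0)}(x)\,dx$. Then for all integers $n,m\ge 2$ $$(m+n+\mu+1)\,I^{(2)}_{n,m}=(m+n+\alpha+\rho-\mu-5)\,I^{(2)}_{n-1,m-1}+(n-m+\alpha-\mu-3)\,I^{(2)}_{n-1,m}+(m-n+\rho-\mu-3)\,I^{(2)}_{n,m-1}.$$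
   Context: $(a)_k=a(a+1)\cdots(a+k-1)$, $(a)_0=1$. For an integer $n\ge 0$, $P_n^{(\alpha,\beta)}$ is the $n$-th Jacobi polynomial, $P_n^{(\alpha,\beta)}(x)=\frac{(\alpha+1)_n}{n!}\sum_{k=0}^n\frac{(-n)_k(n+\alpha+\beta+1)_k}{(\alpha+1)_k\,k!}\left(\frac{1-x}{2}\right)^k$. For an integer $n\ge1$ the integrated Jacobi polynomial is $\widehat{p}_n^{(\alpha,0)}(x)=\int_{-1}^x P_{n-1}^{(\alpha,0)}(s)\,ds$. *)

(* Defs.v *)
(* MathComp-Analysis, over an arbitrary R : realType *)
From HB Require Import structures.
From mathcomp Require Import all_boot all_order all_algebra.
From mathcomp Require Import all_classical all_reals all_analysis.

Set Implicit Arguments.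
Unset Strict Implicit.
Unset Printing Implicit Defensive.

Import Order.TTheory GRing.Theory Num.Theory.
Import numFieldNormedType.Exports.

Local Open Scope classical_set_scope.
Local Open Scope ring_scope.

Definition pochhammer (R : realType) (a : R) (k : nat) : R :=
  \prod_(i < k) (a + i%:R).

Definition jacobi (R : realType) (n : nat) (alpha beta x : R) : R :=
  pochhammer (alpha + 1) n / (n`!)%:R *
  \sum_(k < n.+1)
    pochhammer (- n%:R) k * pochhammer (n%:R + alpha + beta + 1) k /
    (pochhammer (alpha + 1) k * (k`!)%:R) * ((1 - x) / 2) ^+ k.

(* Meaningful for 1 <= n only: n.-1 is truncated at n = 0. *)
Definition int_jacobi (R : realType) (n : nat) (alpha x : R) : R :=
  \int[lebesgue_measure]_(s in `[(-1 : R), x]) jacobi n.-1 alpha 0 s.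

(* The weight ((1 - x) / 2) `^ mu is 1 at x = 1 when mu = 0, and 0 there when
   0 < mu, since 0 `^ 0 = 1 and 0 `^ mu = 0 for mu != 0. *)
Definition I1 (R : realType) (alpha rho mu : R) (n m : nat) : R :=
  \int[lebesgue_measure]_(x in `[(-1 : R), 1])
    (((1 - x) / 2) `^ mu * jacobi n alpha 0 x * jacobi m rho 0 x).

Definition I2 (R : realType) (alpha rho mu : R) (n m : nat) : R :=
  \int[lebesgue_measure]_(x in `[(-1 : R), 1])
    (((1 - x) / 2) `^ mu * int_jacobi n alpha x * int_jacobi m rho x).

(* Main.v *)
Require Import Defs.
From mathcomp Require Import all_boot all_order all_algebra.
From mathcomp Require Import all_classical all_reals all_analysis.
From mathcomp Require Import ring lra.

Set Implicit Arguments.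
Unset Strict Implicit.
Unset Printing Implicit Defensive.

(** Put t = (1 - x) / 2, so that the Jacobi polynomials become polynomials p_n
in t and the weight becomes t^mu.  The recurrences are one integration by
parts, applied to products of sums of consecutive polynomials.

Two facts hold for p_n = P_n^(alpha,0):
- t (p_n + p_(n-1))' = n p_n - (n + alpha) p_(n-1)  ([jacobi_euler]),
  a comparison of coefficients;
- p_n + p_(n-1) vanishes at t = 1, that is at x = -1  ([jacobi_horner1]),
  a summable hypergeometric series ([sum_pochhammer]).

Let q_m be the analogous polynomials for rho, and let
F = (p_n + p_(n-1)) (q_m + q_(m-1)).  By the first fact, t F' is a linear
combination of the four products of one of p_n, p_(n-1) with one of q_m,
q_(m-1).  On the other hand the derivative of t^(mu+1) F with respect to t is
t^mu (t F' + (mu+1) F), so this function has integral zero, because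
t^(mu+1) vanishes at t = 0 and F at t = 1 ([weighted_integral_euler]).
Expanding in the four products gives recurrence (i) with exactly the stated
coefficients; [weighted_recurrence] does this for arbitrary polynomials that
satisfy relations of the same shape.

The integrated polynomials satisfy
t (P_n + P_(n-1))' = n P_n - (n + alpha - 2) P_(n-1)  ([int_jacobi_euler]):
both sides vanish at t = 1, and their derivatives agree by the two facts above
for the index n - 1, since P_n' = - 2 p_(n-1) with respect to t.  As P_n itself
vanishes at t = 1, [weighted_recurrence] then gives (ii). *)

Import Order.TTheory GRing.Theory Num.Theory.
Import numFieldNormedType.Exports.
Local Open Scope classical_set_scope.
Local Open Scope ring_scope.

(** * Integration against the weight ((1 - x) / 2)^mu *)

Lemma half_sub_at_left (R : realType) :
  (1 - x) / 2 @[x --> (1 : R)^'-] --> (0 : R)^'+.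
Proof.
move=> P [e /= e0 eP]; change (\forall x \near (1 : R)^'-, P ((1 - x) / 2)).
near=> x; apply: eP => /=; last first.
  by rewrite divr_gt0// subr_gt0; near: x; exact: nbhs_left_lt.
have x1 : x < 1 by near: x; exact: nbhs_left_lt.
have x2 : 1 - e < x by near: x; apply: nbhs_left_gt; rewrite ltrBlDr ltrDl.
rewrite sub0r normrN ger0_norm; lra.
Unshelve. all: by end_near. Qed.

(** The base of the power vanishes at x = 1.  There a power with s > 0 is only
left-continuous (a negative base gives the value 1), and a power with s = 0 is
continuous only thanks to the convention 0^0 = 1. *)
Lemma continuous_weight (R : realType) (s : R) : 0 <= s ->
  {within `[-1, 1], continuous (fun x : R => ((1 - x) / 2) `^ s)}.
Proof.
rewrite le_eqVlt => /predU1P[<-|s0].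
  rewrite (_ : (fun x : R => _) = cst 1).
    by apply: continuous_subspaceT => x; exact: cvg_cst.
  by apply/funext => x; rewrite powRr0.
have ch (x : R) : (1 - y) / 2 @[y --> x] --> (1 - x) / 2.
  by apply: cvgMl; apply: cvgB; [exact: cvg_cst|exact: cvg_id].
have cw (x : R) : x < 1 -> ((1 - y) / 2) `^ s @[y --> x] --> ((1 - x) / 2) `^ s.
  move=> x1; apply: (cvg_comp (fun y : R => (1 - y) / 2) (@powR R ^~ s) (ch x)).
  apply: (@differentiable_continuous _ R^o R^o _ (@powR R ^~ s)).
  apply/derivable1_diffP/derivable_powR.
  by rewrite in_itv/= andbT divr_gt0// subr_gt0.
apply/continuous_within_itvP; first lra.
split.
- by move=> x; rewrite in_itv/= => /andP[_]; exact: cw.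
- by apply: cvg_at_right_filter; apply: cw; lra.
- rewrite subrr mul0r powR0 ?gt_eqF//.
  apply: (cvg_comp (fun y : R => (1 - y) / 2) (@powR R ^~ s)
    (@half_sub_at_left R)).
  exact: powR_cvg0.
Qed.

Lemma continuous_weighted (R : realType) (s : R) (p : {poly R}) : 0 <= s ->
  {within `[-1, 1], continuous (fun x => ((1 - x) / 2) `^ s * p.[(1 - x) / 2])}.
Proof.
move=> s0 x; apply: cvgM; first exact: (@continuous_weight R s s0 x).
suff: {within `[-1, 1], continuous (fun x : R => p.[(1 - x) / 2])} by exact.
apply: continuous_subspaceT => {}x.
have hx : (1 - y) / 2 @[y --> x] --> (1 - x) / 2.
  by apply: cvgMl; apply: cvgB; [exact: cvg_cst|exact: cvg_id].
apply: (cvg_comp (fun y : R => (1 - y) / 2) (horner p) hx).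
exact: continuous_horner.
Qed.

Definition weighted_integral (R : realType) (mu : R) (p : {poly R}) : R :=
  \int[lebesgue_measure]_(x in `[(-1 : R), 1])
    (((1 - x) / 2) `^ mu * p.[(1 - x) / 2]).

Lemma integrable_weighted (R : realType) (mu : R) (p : {poly R}) : 0 <= mu ->
  lebesgue_measure.-integrable `[(-1 : R), 1]
    (EFin \o (fun x => ((1 - x) / 2) `^ mu * p.[(1 - x) / 2])).
Proof.
move=> mu0; apply: continuous_compact_integrable; first exact: segment_compact.
exact: continuous_weighted.
Qed.

Lemma weighted_integralD (R : realType) (mu : R) (p q : {poly R}) : 0 <= mu ->
  weighted_integral mu (p + q) =
  weighted_integral mu p + weighted_integral mu q.
Proof.
move=> mu0; rewrite /weighted_integral.
under eq_Rintegral do rewrite hornerD mulrDr.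
by rewrite RintegralD//; exact: integrable_weighted.
Qed.

Lemma weighted_integralZ (R : realType) (mu c : R) (p : {poly R}) : 0 <= mu ->
  weighted_integral mu (c *: p) = c * weighted_integral mu p.
Proof.
move=> mu0; rewrite /weighted_integral.
under eq_Rintegral do rewrite hornerZ mulrCA.
by rewrite RintegralZl//; exact: integrable_weighted.
Qed.

(** Fundamental theorem of calculus for - 2 t^(mu+1) p(t) with t = (1 - x) / 2;
the factor - 2 compensates dt/dx.  Only the end x = -1, i.e. t = 1,
contributes, as t^(mu+1) vanishes at t = 0. *)
Lemma weighted_integral_euler (R : realType) (mu : R) (p : {poly R}) : 0 <= mu ->
  weighted_integral mu ('X * p^`() + (mu + 1) *: p) = 2 * p.[1].
Proof.
move=> mu0; have mu1 : 0 <= mu + 1 by lra.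
pose F (x : R) := - 2 * (((1 - x) / 2) `^ (mu + 1) * p.[(1 - x) / 2]).
have cF : {within `[-1, 1], continuous F}.
  move=> x; apply: cvgM; first exact: cvg_cst.
  exact: (@continuous_weighted R _ p mu1 x).
have dF (x : R) : x < 1 -> is_derive x 1 F
    (((1 - x) / 2) `^ mu * ('X * p^`() + (mu + 1) *: p).[(1 - x) / 2]).
  move=> x1; have t0 : 0 < (1 - x) / 2 by rewrite divr_gt0// subr_gt0.
  have dh : is_derive x 1 (fun y : R => (1 - y) / 2) (- 2^-1).
    apply: trigger_derive; rewrite /GRing.scale/=; lra.
  have dw := @is_derive1_comp R (@powR R ^~ (mu + 1)) (fun y => (1 - y) / 2)
    x _ _ (is_derive1_powR (mu + 1) t0) dh.
  have dp := @is_derive1_comp R (horner p) (fun y => (1 - y) / 2)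
    x _ _ (is_derive_poly p ((1 - x) / 2)) dh.
  pose dwp := is_deriveM dw dp.
  have dF := is_deriveM (is_derive_cst (- 2 : R) x 1) dwp.
  apply: (trigger_derive dF).
  rewrite /GRing.scale/= mulr0 addr0 hornerD hornerM hornerX hornerZ.
  rewrite addrK powRD ?powRr1 ?ltW//; last first.
    by rewrite (gt_eqF t0) implybT.
  by field.
rewrite /weighted_integral /Rintegral.
rewrite (@continuous_FTC2 _ _ F)//=.
- rewrite /F subrr mul0r powR0; last by rewrite gt_eqF//; lra.
  rewrite opprK (_ : (1 + 1) / 2 = 1 :> R); last by field.
  by rewrite powR1; ring.
- exact: continuous_weighted.
- have /continuous_within_itvP := cF; case; first lra.
  move=> _ cl cr; split => // x; rewrite in_itv/= => /andP[_ x1].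
  by case: (dF _ x1).
- by move=> x; rewrite in_itv/= => /andP[_ x1]; rewrite derive1E; case: (dF _ x1).
Qed.

Lemma integral_deriv_poly (R : realType) (q : {poly R}) (a b : R) : a <= b ->
  \int[lebesgue_measure]_(s in `[a, b]) q^`().[s] = q.[b] - q.[a].
Proof.
rewrite le_eqVlt => /predU1P[<-|ab].
  by rewrite set_itv1 Rintegral_set1 subrr.
rewrite /Rintegral (@continuous_FTC2 _ _ (horner q))//=.
- by apply: continuous_subspaceT; exact: continuous_horner.
- split => [x _||]; first exact: derivable_horner.
  + by apply: cvg_at_right_filter; exact: continuous_horner.
  + by apply: cvg_at_left_filter; exact: continuous_horner.
- by move=> x _; rewrite derivE.
Qed.

(** * Pochhammer symbols and a summable hypergeometric series *)

Lemma pochhammerSr (R : realType) (a : R) (k : nat) :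
  pochhammer a k.+1 = pochhammer a k * (a + k%:R).
Proof. by rewrite /pochhammer big_ord_recr. Qed.

Lemma pochhammerSl (R : realType) (a : R) (k : nat) :
  pochhammer a k.+1 = a * pochhammer (a + 1) k.
Proof.
rewrite /pochhammer big_ord_recl addr0; congr (_ * _).
by apply: eq_bigr => i _; rewrite lift0 -natr1 addrAC addrA.
Qed.

Lemma pochhammer_neq0 (R : realType) (a : R) (k : nat) :
  0 < a -> pochhammer a k != 0.
Proof.
move=> a0; apply/prodf_neq0 => i _.
by rewrite gt_eqF// ltr_wpDr.
Qed.

Lemma pochhammer_oppn_eq0 (R : realType) (n k : nat) :
  (n < k)%N -> pochhammer (- n%:R : R) k = 0.
Proof.
by move=> nk; rewrite /pochhammer (bigD1 (Ordinal nk))//= addNr mul0r.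
Qed.

(** The lower parameter a + b + 1 is what makes the series telescope:
for d_k = (a+1)_k (b+1)_k / ((a+b+1)_k k!), the k-th term is d_k - d_(k-1),
because (a + k) (b + k) - (a + b + k) k = a b. *)
Lemma sum_pochhammer (R : realType) (a b : R) (K : nat) : 0 < a + b + 1 ->
  \sum_(k < K.+1) pochhammer a k * pochhammer b k /
      (pochhammer (a + b + 1) k * (k`!)%:R) =
  pochhammer (a + 1) K * pochhammer (b + 1) K /
      (pochhammer (a + b + 1) K * (K`!)%:R).
Proof.
move=> c0; elim: K => [|K IH].
  by rewrite big_ord_recr big_ord0 /pochhammer !big_ord0/= add0r.
have c1 : a + b + 1 + K%:R != 0 by rewrite gt_eqF// ltr_wpDr.
have f0 : (K`!)%:R != 0 :> R by rewrite pnatr_eq0 -lt0n fact_gt0.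
have k0 : 1 + K%:R != 0 :> R by rewrite nat1r pnatr_eq0.
have p0 := pochhammer_neq0 K c0.
rewrite big_ord_recr/= IH factS natrM -nat1r (pochhammerSl a) (pochhammerSl b).
rewrite !pochhammerSr.
by field; rewrite c1 f0 k0 p0.
Qed.

(** * Jacobi polynomials in the variable t = (1 - x) / 2 *)

Definition jacobi_coef (R : realType) (n : nat) (a : R) (k : nat) : R :=
  pochhammer (a + 1) n / (n`!)%:R *
  (pochhammer (- n%:R) k * pochhammer (n%:R + a + 1) k /
   (pochhammer (a + 1) k * (k`!)%:R)).

Definition jacobi_poly (R : realType) (n : nat) (a : R) : {poly R} :=
  \poly_(k < n.+1) jacobi_coef n a k.

Lemma jacobi_horner (R : realType) (n : nat) (a x : R) :
  jacobi n a 0 x = (jacobi_poly n a).[(1 - x) / 2].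
Proof.
rewrite /jacobi /jacobi_poly horner_poly mulr_sumr; apply: eq_bigr => k _.
by rewrite addr0 /jacobi_coef !mulrA.
Qed.

Lemma coef_jacobi (R : realType) (n : nat) (a : R) (k : nat) :
  (jacobi_poly n a)`_k = jacobi_coef n a k.
Proof.
rewrite coef_poly ltnS; case: leqP => // nk.
by rewrite /jacobi_coef pochhammer_oppn_eq0// !mul0r mulr0.
Qed.

(** The Pochhammer symbols of the two sides differ by one unit shift each,
(-n-1)_k against (-n)_k and (n+a+2)_k against (n+a+1)_k, and two expansions of
a symbol of length k + 1 express such a shift. *)
Lemma jacobi_coefS (R : realType) (n : nat) (a : R) (k : nat) : -1 < a ->
  (n.+1%:R + a + k%:R) * jacobi_coef n a k =
  (n.+1%:R - k%:R) * jacobi_coef n.+1 a k.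
Proof.
move=> a1; rewrite /jacobi_coef.
have h1 := pochhammerSl (- n.+1%:R : R) k.
have h2 := pochhammerSl (n%:R + a + 1) k.
have e1 : - 1 - n%:R + 1 = - n%:R :> R by ring.
rewrite !pochhammerSr -!nat1r opprD e1 in h1.
rewrite !pochhammerSr in h2.
have e2 : 1 + n%:R + a + 1 = n%:R + a + 1 + 1 by ring.
have c1 : 1 + n%:R != 0 :> R by rewrite nat1r pnatr_eq0.
have f0 : (n`!)%:R != 0 :> R by rewrite pnatr_eq0 -lt0n fact_gt0.
have g0 : (k`!)%:R != 0 :> R by rewrite pnatr_eq0 -lt0n fact_gt0.
have p0 : pochhammer (a + 1) k != 0 by apply: pochhammer_neq0; lra.
rewrite pochhammerSr factS natrM -!nat1r opprD e2.
set A := pochhammer (a + 1) n in h1 h2 *; set B := pochhammer (a + 1) k in p0 *.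
set C := pochhammer (-1 - n%:R) k in h1 h2 *.
set D := pochhammer (n%:R + a + 1) k in h1 h2 *.
set E := pochhammer (n%:R + a + 1 + 1) k in h1 h2 *.
set F := pochhammer (- n%:R) k in h1 h2 *.
have -> : (1 + n%:R + a + k%:R) * (A / n`!%:R * (F * D / (B * k`!%:R))) =
   A / n`!%:R * F / (B * k`!%:R) * (D * (n%:R + a + 1 + k%:R)).
  by field; rewrite f0 g0 p0.
have -> : (1 + n%:R - k%:R) * (A * (a + 1 + n%:R) / ((1 + n%:R) * n`!%:R) *
     (C * E / (B * k`!%:R))) =
   A / n`!%:R * (a + 1 + n%:R) * E / (B * k`!%:R) / (1 + n%:R) *
     - (C * (-1 - n%:R + k%:R)).
  by field; rewrite f0 g0 p0 c1.
rewrite h1 h2.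
by field; rewrite f0 g0 p0 c1.
Qed.

(** The operator t d/dt multiplies the k-th coefficient by k, so this is
[jacobi_coefS] read coefficientwise. *)
Lemma jacobi_euler (R : realType) (n : nat) (a : R) : -1 < a ->
  'X * (jacobi_poly n.+1 a + jacobi_poly n a)^`() =
  n.+1%:R *: jacobi_poly n.+1 a - (n.+1%:R + a) *: jacobi_poly n a.
Proof.
move=> a1; apply/polyP => k.
rewrite coefXM coefB !coefZ !coef_jacobi.
have h := jacobi_coefS n k a1.
case: k h => [|k] /= h; first by rewrite addr0 subr0 in h; rewrite h subrr.
rewrite coef_deriv coefD !coef_jacobi -[LHS]mulr_natr.
have -> : n.+1%:R * jacobi_coef n.+1 a k.+1 =
    (n.+1%:R - k.+1%:R) * jacobi_coef n.+1 a k.+1 +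
    k.+1%:R * jacobi_coef n.+1 a k.+1 by ring.
by rewrite -h; ring.
Qed.

(** Equivalently P_n(-1) = (-1)^n.  By [jacobi_coefS] the coefficients of the sum
are proportional to (-n-1)_k (n+1+a)_k / ((a+1)_k k!), and [sum_pochhammer]
applies with the lower parameter (-n-1) + (n+1+a) + 1 = a + 1; its value
contains the factor (-n)_(n+1) = 0. *)
Lemma jacobi_horner1 (R : realType) (n : nat) (a : R) : -1 < a ->
  (jacobi_poly n.+1 a + jacobi_poly n a).[1] = 0.
Proof.
move=> a1.
have N0 : 0 < n.+1%:R + a :> R by rewrite -nat1r; have := ler0n R n; lra.
have := @sum_pochhammer R (- n.+1%:R) (n.+1%:R + a) n.+1.
have -> : - n.+1%:R + (n.+1%:R + a) + 1 = a + 1 by ring.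
rewrite (_ : - n.+1%:R + 1 = - n%:R); last by rewrite -nat1r; ring.
rewrite (@pochhammer_oppn_eq0 _ n n.+1)// !mul0r => /(_ _) H.
have {}H := H ltac:(lra).
have -> : jacobi_poly n.+1 a + jacobi_poly n a =
    \poly_(k < n.+2) (jacobi_coef n.+1 a k + jacobi_coef n a k).
  apply/polyP => k; rewrite coefD !coef_jacobi coef_poly ltnS.
  case: leqP => // nk; rewrite /jacobi_coef.
  by rewrite !pochhammer_oppn_eq0 ?(ltnW nk)// !mul0r !mulr0 addr0.
rewrite horner_poly.
rewrite -[RHS](mulr0 (pochhammer (a + 1) n.+1 / n.+1`!%:R *
  ((2 * n.+1%:R + a) / (n.+1%:R + a)))) -[X in _ = _ * X]H mulr_sumr.
apply: eq_bigr => k _; rewrite expr1n mulr1.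
have K0 : 0 < n.+1%:R + a + k%:R by rewrite ltr_wpDr.
(* After multiplication by n + 1 + a + k, the coefficient of the lower
   polynomial is a multiple of that of the upper one. *)
have h := jacobi_coefS n k a1.
apply: (mulfI (lt0r_neq0 K0)); rewrite mulrDr h -mulrDl /jacobi_coef.
have h2 := pochhammerSl (n.+1%:R + a) k.
rewrite pochhammerSr in h2.
set P := pochhammer _ n.+1 in h2 *.
set E := pochhammer (n.+1%:R + a + 1) k in h2 *.
set D := pochhammer (n.+1%:R + a) k in h2 *.
transitivity (P / n.+1`!%:R * ((2 * n.+1%:R + a) / (n.+1%:R + a)) *
    (pochhammer (- n.+1%:R) k * (D * (n.+1%:R + a + k%:R)) /
     (pochhammer (a + 1) k * k`!%:R))); last by ring.
rewrite h2.
have g0 : (k`!)%:R != 0 :> R by rewrite pnatr_eq0 -lt0n fact_gt0.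
have f0 : (n.+1`!)%:R != 0 :> R by rewrite pnatr_eq0 -lt0n fact_gt0.
have p0 : pochhammer (a + 1) k != 0 by apply: pochhammer_neq0; lra.
set N := n.+1%:R in N0 *; set F := (n.+1`!)%:R in f0 *.
(* Otherwise [field] reads n.+1%:R as 1 + n%:R and states its side conditions
   in that form. *)
have N1 := lt0r_neq0 N0; clearbody N F.
by field; rewrite f0 g0 p0 N1.
Qed.

(** * Integrated Jacobi polynomials *)

Lemma poly_eq_deriv_horner1 (R : numDomainType) (p q : {poly R}) :
  p^`() = q^`() -> p.[1] = q.[1] -> p = q.
Proof.
move=> dpq pq1; have dr : (p - q)^`() = 0 by rewrite derivB dpq subrr.
have rC : p - q = ((p - q)`_0)%:P.
  apply/polyP => -[|k]; rewrite coefC//=.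
  have := congr1 (fun r : {poly R} => r`_k) dr.
  by rewrite coef_deriv coef0 => /eqP; rewrite mulrn_eq0/= => /eqP.
have := congr1 (horner^~ 1) rC; rewrite /= hornerD hornerN pq1 subrr hornerC.
by move=> c0; apply/eqP; rewrite -subr_eq0 rC -c0.
Qed.

(** The constant term is p`_0 / 0, which is 0 as 0^-1 = 0. *)
Definition antideriv_poly (R : numFieldType) (p : {poly R}) : {poly R} :=
  \poly_(k < (size p).+1) (p`_k.-1 / k%:R).

Lemma deriv_antideriv (R : numFieldType) (p : {poly R}) :
  (antideriv_poly p)^`() = p.
Proof.
apply/polyP => k; rewrite coef_deriv coef_poly ltnS.
case: ltnP => [_|kp]; last by rewrite mul0rn nth_default.
by rewrite -[LHS]mulr_natr divfK// pnatr_eq0.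
Qed.

(** With ds = - 2 du for u = (1 - s) / 2, the integral over [-1, x] is twice the
integral over [t, 1] with respect to u. *)
Definition int_jacobi_poly (R : realType) (n : nat) (a : R) : {poly R} :=
  let q := antideriv_poly (jacobi_poly n.-1 a) in 2 *: (q.[1]%:P - q).

Lemma deriv_int_jacobi (R : realType) (n : nat) (a : R) :
  (int_jacobi_poly n a)^`() = - 2 *: jacobi_poly n.-1 a.
Proof.
by rewrite derivZ derivB derivC sub0r deriv_antideriv scalerN scaleNr.
Qed.

Lemma int_jacobi_horner1 (R : realType) (n : nat) (a : R) :
  (int_jacobi_poly n a).[1] = 0.
Proof. by rewrite hornerZ hornerD hornerN hornerC subrr mulr0. Qed.

Lemma int_jacobi_horner (R : realType) (n : nat) (a x : R) : -1 <= x ->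
  int_jacobi n a x = (int_jacobi_poly n a).[(1 - x) / 2].
Proof.
move=> x1; rewrite /int_jacobi.
set h : {poly R} := 2^-1 *: (1 - 'X).
have hE s : h.[s] = (1 - s) / 2.
  by rewrite hornerZ hornerD hornerN hornerX hornerC mulrC.
have dE s : (int_jacobi_poly n a \Po h)^`().[s] =
    (jacobi_poly n.-1 a).[(1 - s) / 2].
  rewrite deriv_comp deriv_int_jacobi comp_polyZ derivZ derivB derivX derivC.
  rewrite sub0r hornerM !hornerZ horner_comp hE hornerN hornerC.
  by field.
transitivity (\int[lebesgue_measure]_(s in `[(-1 : R), x])
    (int_jacobi_poly n a \Po h)^`().[s]).
  by apply: eq_Rintegral => s _; rewrite jacobi_horner -dE.
rewrite integral_deriv_poly// !horner_comp !hE opprK.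
have -> : (1 + 1) / 2 = 1 :> R by field.
by rewrite int_jacobi_horner1 subr0.
Qed.

(** Both sides vanish at t = 1 (the left one by [jacobi_horner1]), and their
derivatives agree by [jacobi_euler].  Differentiating t G', where
G = P_(n+2) + P_(n+1), produces the extra summand G' = - 2 (p_(n+1) + p_n);
it raises the coefficient n + 1 of p_(n+1) to n + 2 and lowers n + 1 + a, that
of - p_n, to n + a = (n + 2) + a - 2. *)
Lemma int_jacobi_euler (R : realType) (n : nat) (a : R) : -1 < a ->
  'X * (int_jacobi_poly n.+2 a + int_jacobi_poly n.+1 a)^`() =
  n.+2%:R *: int_jacobi_poly n.+2 a
  - (n.+2%:R + a - 2) *: int_jacobi_poly n.+1 a.
Proof.
move=> a1; apply: poly_eq_deriv_horner1; last first.
  rewrite hornerM derivD !deriv_int_jacobi/= -scalerDr hornerZ jacobi_horner1//.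
  rewrite hornerD hornerN !(hornerZ _ (int_jacobi_poly _ _)).
  by rewrite !int_jacobi_horner1 !mulr0 subrr.
rewrite derivM derivX mul1r derivB !(derivZ _ (int_jacobi_poly _ _)).
rewrite derivD !deriv_int_jacobi/= -scalerDr derivZ -scalerAr jacobi_euler//.
rewrite -!mul_polyC -!nat1r; ring.
Qed.

(** * The recurrences *)

(** [weighted_integral_euler] for F = (p1 + p0) (q1 + q0), whose value at 1 is
zero; by the hypotheses 'X * F^`() is a combination of the four products. *)
Lemma weighted_recurrence (R : realType) (mu a b c d : R)
    (p1 p0 q1 q0 : {poly R}) :
  0 <= mu ->
  'X * (p1 + p0)^`() = a *: p1 - b *: p0 ->
  'X * (q1 + q0)^`() = c *: q1 - d *: q0 ->
  (p1 + p0).[1] = 0 ->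
  (a + c + mu + 1) * weighted_integral mu (p1 * q1) =
    (b + d - mu - 1) * weighted_integral mu (p0 * q0) +
    (b - c - mu - 1) * weighted_integral mu (p0 * q1) +
    (d - a - mu - 1) * weighted_integral mu (p1 * q0).
Proof.
move=> mu0 hp hq p10.
have := weighted_integral_euler ((p1 + p0) * (q1 + q0)) mu0.
rewrite hornerM p10 mul0r mulr0.
have -> : 'X * ((p1 + p0) * (q1 + q0))^`() +
    (mu + 1) *: ((p1 + p0) * (q1 + q0)) =
   (a + c + mu + 1) *: (p1 * q1) + (- (b + d - mu - 1)) *: (p0 * q0) +
   (- (b - c - mu - 1)) *: (p0 * q1) + (- (d - a - mu - 1)) *: (p1 * q0).
  rewrite derivM mulrDr mulrA hp mulrCA hq -!mul_polyC.
  by rewrite !(polyCN, polyCD, polyCB); ring.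
rewrite !weighted_integralD// !weighted_integralZ//.
move=> h; apply/eqP; rewrite -subr_eq0 -h; apply/eqP; ring.
Qed.

Lemma I1E (R : realType) (alpha rho mu : R) (n m : nat) :
  I1 alpha rho mu n m =
  weighted_integral mu (jacobi_poly n alpha * jacobi_poly m rho).
Proof.
by apply: eq_Rintegral => x _; rewrite !jacobi_horner hornerM mulrA.
Qed.

Lemma I2E (R : realType) (alpha rho mu : R) (n m : nat) :
  I2 alpha rho mu n m =
  weighted_integral mu (int_jacobi_poly n alpha * int_jacobi_poly m rho).
Proof.
apply: eq_Rintegral => x; rewrite inE/= in_itv/= => /andP[x1 _].
by rewrite !int_jacobi_horner// hornerM mulrA.
Qed.

Theorem theorem4p1 (R : realType) (alpha rho mu : R)
    (halpha : -1 < alpha) (hrho : -1 < rho) (hmu : 0 <= mu) :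
  (forall n m : nat, (1 <= n)%N -> (1 <= m)%N ->
     (m%:R + n%:R + mu + 1) * I1 alpha rho mu n m =
       (m%:R + n%:R + alpha + rho - mu - 1) * I1 alpha rho mu n.-1 m.-1 +
       (n%:R - m%:R + alpha - mu - 1) * I1 alpha rho mu n.-1 m +
       (m%:R - n%:R + rho - mu - 1) * I1 alpha rho mu n m.-1)
  /\
  (forall n m : nat, (2 <= n)%N -> (2 <= m)%N ->
     (m%:R + n%:R + mu + 1) * I2 alpha rho mu n m =
       (m%:R + n%:R + alpha + rho - mu - 5) * I2 alpha rho mu n.-1 m.-1 +
       (n%:R - m%:R + alpha - mu - 3) * I2 alpha rho mu n.-1 m +
       (m%:R - n%:R + rho - mu - 3) * I2 alpha rho mu n m.-1).
Proof.
split=> [[//|n] [//|m] _ _|[//|[//|n]] [//|[//|m]] _ _].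
- rewrite !I1E/=.
  have h := weighted_recurrence hmu (jacobi_euler n halpha)
    (jacobi_euler m hrho) (jacobi_horner1 n halpha).
  by rewrite [m.+1%:R + _]addrC h; congr (_ * _ + _ * _ + _ * _); ring.
- rewrite !I2E/=.
  have p0 : (int_jacobi_poly n.+2 alpha + int_jacobi_poly n.+1 alpha).[1] = 0.
    by rewrite hornerD !int_jacobi_horner1 addr0.
  have h := weighted_recurrence hmu (int_jacobi_euler n halpha)
    (int_jacobi_euler m hrho) p0.
  by rewrite [m.+2%:R + _]addrC h; congr (_ * _ + _ * _ + _ * _); ring.
Qed.
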